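(* Let $G$ be the group of order 16 given by the presentation $$ G=\langle X,Y,Z \mid Z^4=Y^4=X^2=1,\; XZ=Z^{-1}X,\; Z^2=Y^2,\; XY=YX,\; ZY=YZ\rangle $$ (SmallGroup(16,13)), and let $H=\mathbb{Z}_2\times D_8$, where $\mathbb{Z}_2$ is the cyclic group of order 2 and $D_8$ is the dihedral group of order 8. Then $G$ and $H$ have the same integer group determinants, i.e. $$\{\mathcal{D}_G(\alpha):\alpha\in\mathbb{Z}[G]\}=\{\mathcal{D}_H(\beta):\beta\in\mathbb{Z}[H]\}.$$ In particular, the integer group determinants do not determine the group: there exist non-isomorphic finite groups (namely $G$ and $H$) with the same set of integer group determinants.
   Context: For a finite group $K$ and an element $\sum_{g\in K} a_g g$ of the integral group ring $\mathbb{Z}[K]$ (so $a_g\in\mathbb{Z}$), the integer group determinant is $$\mathcal{D}_K\Big(\sum_{g\in K} a_g g\Big):=\det\big(a_{gh^{-1}}\big)_{g,h\in K},$$ the determinant of the $|K|\times|K|$ matrix with rows and columns indexed by the elements of $K$ (in the same order). The integer group determinants of $K$ are all the integers obtained as $\mathcal{D}_K(\alpha)$ with $\alpha\in\mathbb{Z}[K]$. The name SmallGroup(16,13) refers to GAP's small group library; this group is the central product of the dihedral group of order eight $\langle X,Z\rangle$ and the cyclic group of order four $\langle Y\rangle$ over a common central subgroup of order two. *)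

(* Defs.v *)
From HB Require Import structures.
From mathcomp Require Import all_boot all_order all_algebra.
From mathcomp Require Import all_fingroup all_solvable.

Set Implicit Arguments.
Unset Strict Implicit.
Unset Printing Implicit Defensive.

Import GRing.Theory.
Local Open Scope ring_scope.

(* Finite groups are finGroupTypes, the group being the whole type; an element
   \sum_g a_g g of Z[K] is its coefficient family g |-> a_g. *)
Definition int_group_ring (K : finGroupType) := {ffun K -> int}.

Definition group_matrix (K : finGroupType) (a : int_group_ring K) :
    'M[int]_#|K| :=
  \matrix_(i, j) a (enum_val i * (enum_val j)^-1)%g.

Definition group_det (K : finGroupType) (a : int_group_ring K) : int :=
  \det (group_matrix a).

Definition is_integer_group_det (K : finGroupType) (n : int) : Prop :=
  exists a : int_group_ring K, group_det a = n.

Definition same_integer_group_dets (K L : finGroupType) : Prop :=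
  forall n : int, is_integer_group_det K n <-> is_integer_group_det L n.

(* In the group presentation syntax a lone word w stands for w = 1. *)
Definition SmallGroup_16_13_presented (K : finGroupType) : Prop :=
  ([set: K] \isog Grp (X : Y : Z :
     (Z ^+ 4, Y ^+ 4, X ^+ 2, X * Z = Z^-1 * X,
      Z ^+ 2 = Y ^+ 2, X * Y = Y * X, Z * Y = Y * Z)))%g.

(* The group law of 'Z_2 as a finGroupType is addition mod 2, and 'D_8 is the
   dihedral group of order 8. *)
Definition Z2xD8 : finGroupType := ('Z_2 * 'D_8)%type.

(* Main.v *)
(** Both groups are extensions of Z_2^3 by a central involution c, given by
    bilinear cocycles that differ in one term: Y^2 = c in G and Y^2 = 1 in
    Z_2 x D_8. With s = a(g) + a(cg) and t = a(g) - a(cg), which are arbitrary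
    subject to s = t mod 2, splitting the regular representation along c and
    then along Y gives the determinant F(u) F(v) Q(t)^2. Here F is the Z_2^2
    determinant, u and v are the sum and the difference of the two halves of s,
    and Q(t) = (N p + w N q)^2 - 4 w B(p, q)^2 for t = (p, q), w = Y^2 = +-1, N
    the norm form of the quaternion algebra with X^2 = 1, Z^2 = -1, and B its
    polar form.

    In either group the values are the integers 16k + 1, the products
    (8j - 3)(8j' - 3) with j = j' mod 2, and the multiples of 2^16. For odd
    values, F(v) Q^2 = F(u) mod 16 while F(u) is 1 or 5 mod 8. For even values,
    the powers of 2 dividing F(u), F(v) and Q depend on the parities of the four
    coordinates of u and of the sum of q. Conversely, adding constants to s
    changes only one or two of the eight linear factors, and this realizes every
    listed value. *)

Require Import Defs.
From HB Require Import structures.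
From mathcomp Require Import all_boot all_order all_algebra.
From mathcomp Require Import all_fingroup all_solvable all_field.
From mathcomp Require Import ring zify.

Set Implicit Arguments.
Unset Strict Implicit.
Unset Printing Implicit Defensive.

Import GRing.Theory Num.Theory.

(** * The two groups as central extensions of Z_2^3 *)

(* [(e, (y, (x, z)))] stands for [X^x Z^z Y^y c^e], where [c = Z^2] is central and
   [Y^2 = c^eps]; the copy [central_ext] carries this group law, since products of
   [bool] already have the componentwise one. *)
Definition central_ext (eps : bool) : Type := (bool * (bool * (bool * bool)))%type.

HB.instance Definition _ eps :=
  Finite.copy (central_ext eps) (bool * (bool * (bool * bool)))%type.

Section CentralExtension.
Local Open Scope ring_scope.
Variable eps : bool.

(** Sorting a product yields the powers of c: [z * x'] from ZX = XZc, [z * z'] from Z^2 = c, and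
    [eps * y * y'] from Y^2 = c^eps. *)
Definition ext_mul (g h : central_ext eps) : central_ext eps :=
  let: (e, (y, (x, z))) := g in let: (e', (y', (x', z'))) := h in
  (e + e' + z * x' + z * z' + eps * y * y', (y + y', (x + x', z + z'))).

Definition ext_inv (g : central_ext eps) : central_ext eps :=
  let: (e, (y, (x, z))) := g in (e + z * x + z + eps * y, (y, (x, z))).

Definition ext_one : central_ext eps := (0, (0, (0, 0))).

Lemma ext_mulA : associative ext_mul.
Proof.
move=> [e1 [y1 [x1 z1]]] [e2 [y2 [x2 z2]]] [e3 [y3 [x3 z3]]] /=.
by rewrite !addrA; congr (_, _); ring.
Qed.

Lemma ext_mul1 : left_id ext_one ext_mul.
Proof. by move=> [e [y [x z]]] /=; rewrite !(add0r, mul0r, mulr0, addr0). Qed.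

Lemma ext_mulV : left_inverse ext_one ext_inv ext_mul.
Proof. by move=> [[] [[] [[] []]]]; vm_compute; case: eps. Qed.

HB.instance Definition _ :=
  isMulGroup.Build (central_ext eps) ext_mulA ext_mul1 ext_mulV.
End CentralExtension.

Lemma ext_mulE eps (g h : central_ext eps) : (g * h)%g = ext_mul g h.
Proof. by []. Qed.

Lemma card_central_ext eps : #|{: central_ext eps}| = 16.
Proof. by rewrite !card_prod !card_bool. Qed.

(** * Universal property and identification of the two groups *)

Section Universal.
Local Open Scope group_scope.
Variables (rT : finGroupType) (eps : bool) (x y z : rT).
Hypotheses (x2 : x ^+ 2 = 1) (z4 : z ^+ 4 = 1) (xz : x * z = z^-1 * x).
Hypotheses (xy : commute x y) (zy : commute z y).
Hypothesis y2 : y ^+ 2 = if eps then z ^+ 2 else 1.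

Definition ext_map (g : central_ext eps) : rT :=
  let: (b, (j, (i, k))) := g in
  x ^+ i * z ^+ k * y ^+ j * (z ^+ 2) ^+ b.

(** The hypotheses are the defining relations, so any group generated by such a triple becomes an
    image of the extension. *)
Lemma ext_mapM : {in setT &, {morph ext_map : g h / g * h}}.
Proof.
have zx : z * x = x * z * z ^+ 2.
  have zV : z^-1 = z ^+ 3 by apply: (mulgI z); rewrite mulgV -expgS z4.
  by rewrite -mulgA -expgS -zV; apply: (mulgI z^-1); rewrite mulKg mulgA -xz mulgK.
have cx : commute x (z ^+ 2).
  rewrite /commute expg2 mulgA xz -mulgA xz mulgA -invMg -expg2; congr (_ * _).
  by apply: (mulgI (z ^+ 2)); rewrite mulgV -expgD z4.
have cy : commute y (z ^+ 2) by apply/commuteX/commute_sym.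
have cz : commute z (z ^+ 2) by apply: commuteX.
have addX (b b' : bool) (u : rT) :
    u ^+ b * u ^+ b' = u ^+ (b + b')%R * (u ^+ 2) ^+ (b && b').
  by case: b b' => [] []; rewrite ?(expg0, mulg1, mul1g).
have c2 : (z ^+ 2) ^+ 2 = 1 by rewrite -expgM.
have zxX (k i : bool) : z ^+ k * x ^+ i = x ^+ i * z ^+ k * (z ^+ 2) ^+ (k && i).
  by case: k i => [] []; rewrite ?(expg0, mulg1, mul1g).
move=> [b [j [i k]]] [b' [j' [i' k']]] _ _; rewrite ext_mulE /=.
have -> : (b + b' + k * i' + k * k' + eps * j * j' =
           k * i' + (k * k' + (eps * j * j' + (b + b'))))%R by ring.
have xD (u v : bool) : x ^+ (u + v : bool)%R = x ^+ u * x ^+ v.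
  by rewrite addX x2 expg1n mulg1.
have zD (u v : bool) :
    z ^+ (u + v : bool)%R * (z ^+ 2) ^+ (u * v : bool)%R = z ^+ u * z ^+ v.
  by rewrite addX.
have yD (u v : bool) :
    y ^+ (u + v : bool)%R * (z ^+ 2) ^+ (eps * u * v : bool)%R = y ^+ u * y ^+ v.
  by rewrite addX y2; case: (eps) u v => [] [] []; rewrite ?expg1n ?expg0.
pose C (u : bool) := (z ^+ 2) ^+ u.
have cX (u v : bool) : commute (x ^+ u) (C v) by apply: commuteX2.
have cY (u v : bool) : commute (y ^+ u) (C v) by apply: commuteX2.
have cZ (u v : bool) : commute (z ^+ u) (C v) by apply: commuteX2.
have XY (u v : bool) : commute (x ^+ u) (y ^+ v) by apply: commuteX2.
have ZY (u v : bool) : commute (z ^+ u) (y ^+ v) by apply: commuteX2.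
have cD (u v : bool) : C (u + v)%R = C u * C v.
  by rewrite /C addX c2 expg1n mulg1.
rewrite -!/(C _) !cD.
(* This word still contains [z ^+ k * x ^+ i']. Sorting it absorbs the three cocycle terms; reaching
   it from the product only moves y and the central c. *)
transitivity (x ^+ i * (z ^+ k * x ^+ i') * z ^+ k' * (y ^+ j * y ^+ j') * (C b * C b')).
  rewrite zxX -yD xD -!/(C _) -!mulgA; congr (_ * (_ * _)).
  rewrite (mulgA (C _) (z ^+ k')) -cZ -!mulgA (mulgA (z ^+ k)) -zD -!/(C _) -!mulgA.
  congr (_ * _); rewrite (mulgA (C (k && i')) (y ^+ _)) -cY -mulgA.
  rewrite (mulgA (C _) (y ^+ _)) -cY.
  by rewrite -!mulgA -!cD; congr (_ * C _); apply: addrCA.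
rewrite -!mulgA; congr (_ * (_ * _)).
rewrite (mulgA (C b)) -cX -!mulgA (mulgA (y ^+ j) (x ^+ i')) -XY -!mulgA; congr (_ * _).
rewrite (mulgA (C b)) -cZ -!mulgA (mulgA (y ^+ j) (z ^+ k')) -ZY -!mulgA; congr (_ * _).
by rewrite (mulgA (C b)) -cY -!mulgA.
Qed.

Canonical ext_morphism := Morphism ext_mapM.

Lemma im_ext_map : ext_map @* setT = <[x]> <*> <[y]> <*> <[z]>.
Proof.
apply/eqP; rewrite eqEsubset; apply/andP; split.
  apply/subsetP => _ /morphimP[[b [j [i k]]] _ _ ->] /=.
  have [Gx Gy Gz] : [/\ x \in <[x]> <*> <[y]> <*> <[z]>,
     y \in <[x]> <*> <[y]> <*> <[z]> & z \in <[x]> <*> <[y]> <*> <[z]>].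
    by split; last (by rewrite mem_gen // inE cycle_id orbT);
      apply: (subsetP (joing_subl _ _)); rewrite mem_gen // inE cycle_id ?orbT.
  by rewrite /ext_map !(groupM, groupX).
rewrite !join_subG !cycle_subG; apply/andP; split; [apply/andP; split|];
 [rewrite (_ : x = ext_map (false, (false, (true, false))))
 |rewrite (_ : y = ext_map (false, (true, (false, false))))
 |rewrite (_ : z = ext_map (false, (false, (false, true))))];
 by rewrite ?mem_morphim ?inE //= ?(expg0, mulg1, mul1g).
Qed.
End Universal.

Section Identification.
Local Open Scope group_scope.

Definition ext_x eps : central_ext eps := (false, (false, (true, false))).
Definition ext_y eps : central_ext eps := (false, (true, (false, false))).
Definition ext_z eps : central_ext eps := (false, (false, (false, true))).

Lemma ext_gen eps :
  [set: central_ext eps] = <[ext_x eps]> <*> <[ext_y eps]> <*> <[ext_z eps]>.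
Proof.
set x := ext_x eps; set y := ext_y eps; set z := ext_z eps.
apply/esym/eqP; rewrite eqEsubset subsetT; apply/subsetP => [[b [j [i k]]]] _.
have -> : ((b, (j, (i, k))) : central_ext eps) =
          x ^+ i * z ^+ k * y ^+ j * (z ^+ 2) ^+ b.
  by rewrite {}/x {}/y {}/z; case: b j i k => [] [] [] []; vm_compute; case: eps.
have [Gx Gy] : x \in <[x]> <*> <[y]> <*> <[z]> /\ y \in <[x]> <*> <[y]> <*> <[z]>.
  by split; apply: (subsetP (joing_subl _ _)); rewrite mem_gen // inE cycle_id ?orbT.
have Gz : z \in <[x]> <*> <[y]> <*> <[z]> by rewrite mem_gen // inE cycle_id orbT.
by rewrite !(groupM, groupX).
Qed.

Lemma central_ext_presented : SmallGroup_16_13_presented (central_ext true).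
Proof.
apply: intro_isoGrp.
  apply/existsP; exists (ext_x true, ext_y true, ext_z true).
  by rewrite /= -ext_gen !xpair_eqE !eqxx.
move=> rT H /existsP[[[x y] z]] /=.
rewrite !xpair_eqE => /and5P[/eqP <- /eqP z4 /eqP y4 /eqP x2].
case/and4P=> /eqP xz /eqP zy2 /eqP xy /eqP zy.
by rewrite -(im_ext_map (eps := true) x2 z4 xz xy zy (esym zy2)) morphim_homg.
Qed.

(** Sending X, Z to a reflection and a rotation of D_8 and Y to the generator of Z_2 gives a
    surjection, and both orders are 16. *)
Lemma central_ext_false_isog : [set: central_ext false] \isog [set: Z2xD8].
Proof.
have /existsP[[z x]] : [set: 'D_8] \homg Grp (x : y : x ^+ 4, y ^+ 2, x ^ y = x^-1).
  exact/isoGrp_hom/(Grp_dihedral (q := 4)).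
rewrite /= !xpair_eqE => /and4P[/eqP defD /eqP z4 /eqP x2 /eqP zx].
pose X : Z2xD8 := pair1g _ x; pose Z : Z2xD8 := pair1g _ z.
pose Y : Z2xD8 := (1%R : 'Z_2, 1).
have X2 : X ^+ 2 = 1 by rewrite -morphX ?inE // x2 morph1.
have Z4 : Z ^+ 4 = 1 by rewrite -morphX ?inE // z4 morph1.
have XZ : X * Z = Z^-1 * X.
  have xz : x * z = z^-1 * x.
    rewrite -zx conjgE -!mulgA -expg2 x2 mulg1; congr (_ * _).
    by apply: (mulgI x); rewrite -expg2 x2 mulgV.
  by rewrite -morphM ?inE // xz morphM ?inE // morphV ?inE.
have XY : commute X Y by congr (_, _); rewrite ?(mulg1, mul1g).
have ZY : commute Z Y by congr (_, _); rewrite ?(mulg1, mul1g).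
have Y2 : Y ^+ 2 = 1 by congr (_, _); rewrite ?(mulg1, mul1g) //; apply/val_inj.
rewrite isog_sym isogEcard; apply/andP; split.
  apply/homgP; exists (ext_morphism (eps := false) X2 Z4 XZ XY ZY Y2).
  rewrite im_ext_map; apply/eqP; rewrite eqEsubset subsetT; apply/subsetP => [[w d]] _.
  have -> : (w, d) = pair1g _ d * Y ^+ w.
    case: w => [[|[|//]] w2] /=; rewrite ?expg0 ?mulg1 ?expg1; congr (_, _);
      rewrite ?(mulg1, mul1g) //; exact/val_inj.
  set K := <[X]> <*> <[Y]> <*> <[Z]>.
  have [KX KY] : X \in K /\ Y \in K.
    by split; apply: (subsetP (joing_subl _ _)); rewrite mem_gen // inE cycle_id ?orbT.
  have KZ : Z \in K by rewrite mem_gen // inE cycle_id orbT.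
  rewrite groupM ?groupX //.
  have sub : @pair1g ('Z_2)%type ('D_8)%type @* (<[z]> <*> <[x]>) \subset K.
    by rewrite morphimY ?subsetT // !morphim_cycle ?inE // join_subG !cycle_subG KX KZ.
  by apply: (subsetP sub); rewrite mem_morphim ?inE // defD inE.
by rewrite !cardsT card_central_ext card_prod card_ord -cardsT (card_dihedral (q := 4)).
Qed.

(** For [eps = true] the central element Y has order 4; for [eps = false] all central elements
    square to 1. *)
Lemma central_ext_not_isog :
  ~ ([set: central_ext true] \isog [set: central_ext false]).
Proof.
case/isogP=> f injf imf.
have fsurj h : exists g, h = f g.
  have /morphimP[g _ _ ->] : h \in f @* setT by rewrite imf inE.
  by exists g.
have y_central (g : central_ext true) : commute (ext_y true) g.
  by case: g => [[] [[] [[] []]]].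
have z2 (h : central_ext false) : (forall h', commute h h') -> h ^+ 2 = 1.
  move=> ch; have := ch (ext_x false); have := ch (ext_z false).
  by case: h ch => [[] [[] [[] []]]].
have /eqP : f (ext_y true) ^+ 2 = 1.
  apply: z2 => h'; have [g ->] := fsurj h'.
  by rewrite /commute -!morphM ?inE // y_central.
rewrite -morphX ?inE // -(morph1 f) => /eqP /(injmP injf).
by rewrite !inE => /(_ isT isT).
Qed.

Lemma presented_isog (G : finGroupType) : SmallGroup_16_13_presented G ->
  [set: G] \isog [set: central_ext true].
Proof.
move=> presG; rewrite isogEhom.
by rewrite (central_ext_presented [set: G]%G) (presG _ [set: central_ext true]%G)
  (isoGrp_hom presG) (isoGrp_hom central_ext_presented).
Qed.

End Identification.

Local Open Scope ring_scope.

(** * Factorization of the determinants *)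

(** Rows and columns undergo the same permutation, so the signs cancel. *)
Lemma det_reindex (R : comNzRingType) m n (f : 'I_m -> 'I_n) (A : 'M[R]_n) :
  bijective f -> \det (\matrix_(i, j) A (f i) (f j)) = \det A.
Proof.
move=> bijf; have eqmn : m = n by rewrite -(card_ord m) -(card_ord n) (bij_eq_card bijf).
case: n / eqmn f A bijf => f A bijf.
pose s := perm (bij_inj bijf).
have -> : \matrix_(i, j) A (f i) (f j) = row_perm s (col_perm s A).
  by apply/matrixP => i j; rewrite !mxE !permE.
by rewrite row_permE col_permE !det_mulmx !det_perm mulrCA -signr_addb odd_permV
   addbb mulr1.
Qed.

Lemma group_det_reindex (K : finGroupType) m (e : 'I_m -> K) (a : int_group_ring K) :
  bijective e -> group_det a = \det (\matrix_(i, j) a (e i * (e j)^-1)%g).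
Proof.
move=> bije; rewrite /group_det -(det_reindex (f := fun i => enum_rank (e i))); last first.
  exact/bij_comp/bije/enum_rank_bij.
by congr (\det _); apply/matrixP => i j; rewrite !mxE !enum_rankK.
Qed.

Lemma isog_is_integer_group_det (K L : finGroupType) n :
  ([set: K] \isog [set: L])%g -> is_integer_group_det K n -> is_integer_group_det L n.
Proof.
rewrite isog_sym => isoLK [a <-]; have /isogP[f injf _] := isoLK.
have bijf : bijective f.
  apply: inj_card_bij => [g h eqfgh|]; first by apply: (injmP injf); rewrite ?inE.
  by have := card_isog isoLK; rewrite !cardsT => ->.
exists [ffun g => a (f g)].
have bije : bijective (fun i : 'I_#|L|%N => f (enum_val i)).
  exact/bij_comp/enum_val_bij.
rewrite (group_det_reindex a bije).
by congr (\det _); apply/matrixP => i j; rewrite !mxE ffunE morphM ?morphV ?inE.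
Qed.

Section Doubling.
Variables (R : comNzRingType) (T : Type) (m : nat) (e : 'I_m -> T).

Definition dbl (i : 'I_(m + m)) : bool * T :=
  match split i with inl j => (false, e j) | inr j => (true, e j) end.

Lemma dbl_bij : bijective e -> bijective dbl.
Proof.
case=> g eK gK.
exists (fun p : bool * T => unsplit (if p.1 then inr (g p.2) else inl (g p.2))).
  by move=> i; rewrite /dbl; case: splitP => j ij /=; rewrite eK; apply: val_inj.
by case=> [[] t]; rewrite /dbl unsplitK /= gK.
Qed.

Lemma dbl_mx (A : bool * T -> bool * T -> R) :
  \matrix_(i, j) A (dbl i) (dbl j) =
  block_mx (\matrix_(i, j) A (false, e i) (false, e j))
           (\matrix_(i, j) A (false, e i) (true, e j))
           (\matrix_(i, j) A (true, e i) (false, e j))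
           (\matrix_(i, j) A (true, e i) (true, e j)).
Proof.
apply/matrixP => i j; rewrite -(splitK i) -(splitK j) /dbl.
by case: (split i) => i'; case: (split j) => j' /=;
  rewrite ?(block_mxEul, block_mxEur, block_mxEdl, block_mxEdr) !mxE
    ?(unsplitK (inl _)) ?(unsplitK (inr _)).
Qed.
End Doubling.

(** Conjugation by the unipotent [L w] makes the matrix block triangular. It serves to split along c
    and along Y, by their eigenvalues [w] and [- w]. *)
Lemma det_block_twist (R : comNzRingType) n (w : R) (P Q : 'M[R]_n) :
  \det (block_mx P (w ^+ 2 *: Q) Q P) = \det (P + w *: Q) * \det (P - w *: Q).
Proof.
pose L (v : R) : 'M[R]_(n + n) := block_mx 1%:M v%:M 0 1%:M.
have detL v : \det (L v) = 1 by rewrite det_ublock !det1 mulr1.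
rewrite -(det_lblock (P + w *: Q) Q (P - w *: Q)).
have <- : L w *m block_mx P (w ^+ 2 *: Q) Q P *m L (- w) =
          block_mx (P + w *: Q) 0 Q (P - w *: Q).
  rewrite !mulmx_block !(mul1mx, mulmx1, mul0mx, mulmx0, addr0, add0r).
  rewrite !mul_mx_scalar !mul_scalar_mx.
  by congr (block_mx _ _ _ _); apply/matrixP => i j; rewrite !mxE; ring.
by rewrite !det_mulmx !detL mulr1 mul1r.
Qed.

(** With indices in [nat], the minors of a row expansion keep this form and their entries
    compute. *)
Definition natmx (R : Type) n (F : nat -> nat -> R) : 'M[R]_n := \matrix_(i, j) F i j.

Lemma det_natmx_recl (R : comNzRingType) n (F : nat -> nat -> R) :
  \det (natmx n.+1 F) =
  \sum_(k < n.+1) (-1) ^+ k * F 0%N k *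
     \det (natmx n (fun i j => F i.+1 (bump k j))).
Proof.
rewrite (expand_det_row _ ord0); apply: eq_bigr => k _; rewrite !mxE mulrCA mulrA.
by congr (_ * _ * \det _); apply/matrixP => i j; rewrite !mxE.
Qed.

Lemma det_natmx4 (R : comNzRingType) (F : nat -> nat -> R) :
  \det (natmx 4 F) =
    F 0%N 0%N *
      (F 1%N 1%N * (F 2%N 2%N * F 3%N 3%N - F 2%N 3%N * F 3%N 2%N)
       - F 1%N 2%N * (F 2%N 1%N * F 3%N 3%N - F 2%N 3%N * F 3%N 1%N)
       + F 1%N 3%N * (F 2%N 1%N * F 3%N 2%N - F 2%N 2%N * F 3%N 1%N))
  - F 0%N 1%N *
      (F 1%N 0%N * (F 2%N 2%N * F 3%N 3%N - F 2%N 3%N * F 3%N 2%N)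
       - F 1%N 2%N * (F 2%N 0%N * F 3%N 3%N - F 2%N 3%N * F 3%N 0%N)
       + F 1%N 3%N * (F 2%N 0%N * F 3%N 2%N - F 2%N 2%N * F 3%N 0%N))
  + F 0%N 2%N *
      (F 1%N 0%N * (F 2%N 1%N * F 3%N 3%N - F 2%N 3%N * F 3%N 1%N)
       - F 1%N 1%N * (F 2%N 0%N * F 3%N 3%N - F 2%N 3%N * F 3%N 0%N)
       + F 1%N 3%N * (F 2%N 0%N * F 3%N 1%N - F 2%N 1%N * F 3%N 0%N))
  - F 0%N 3%N *
      (F 1%N 0%N * (F 2%N 1%N * F 3%N 2%N - F 2%N 2%N * F 3%N 1%N)
       - F 1%N 1%N * (F 2%N 0%N * F 3%N 2%N - F 2%N 2%N * F 3%N 0%N)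
       + F 1%N 2%N * (F 2%N 0%N * F 3%N 1%N - F 2%N 1%N * F 3%N 0%N)).
Proof.
rewrite !(det_natmx_recl, big_ord_recl, big_ord0, det_mx00) /= !expr0.
have bumpE h k : bump h k = if (h <= k)%N then k.+1 else k by rewrite /bump; case: leq.
by rewrite !bumpE /=; ring.
Qed.

Definition klein (i : nat) : bool * bool := ((1 < i)%N, odd i).

Lemma klein_bij : bijective (fun i : 'I_4 => klein i).
Proof.
apply: inj_card_bij; last by rewrite card_prod card_bool card_ord.
by case=> [[|[|[|[|//]]]]] ? [[|[|[|[|//]]]]] ? //= _; apply/val_inj.
Qed.

Lemma pair_boolD (x z x' z' : bool) :
  (x, z) + (x', z') = (x (+) x', z (+) z').
Proof. by []. Qed.

(* The power of [c] in the product of [X^x Z^z] and the inverse of [X^x' Z^z']. *)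
Definition twist (g h : bool * bool) : bool :=
  let: (x, z) := g in let: (x', z') := h in z' * x' + z' + z * x' + z * z'.

(* Here and below [u (x, z)] is the coefficient of [X^x Z^z]. *)
Definition klein_norm (R : comNzRingType) (u : bool * bool -> R) : R :=
  ((u (false, false) + u (true, false)) ^+ 2 - (u (false, true) + u (true, true)) ^+ 2) *
  ((u (false, false) - u (true, false)) ^+ 2 - (u (false, true) - u (true, true)) ^+ 2).

Definition quat_norm (R : comNzRingType) (u : bool * bool -> R) : R :=
  u (false, false) ^+ 2 - u (true, false) ^+ 2 + u (false, true) ^+ 2 - u (true, true) ^+ 2.

Lemma det_klein (R : comNzRingType) (u : bool * bool -> R) :
  \det (\matrix_(i < 4, j < 4) u (klein i + klein j)) = klein_norm u.
Proof.
rewrite -/(natmx 4 (fun i j => u (klein i + klein j))) det_natmx4 /klein /klein_norm.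
by rewrite !pair_boolD /=; ring.
Qed.

(** For c = -1, X and Z generate a quaternion algebra, where multiplication by an element has the
    squared reduced norm as determinant. *)
Lemma det_klein_twist (R : comNzRingType) (u : bool * bool -> R) :
  \det (\matrix_(i < 4, j < 4)
     ((-1) ^+ twist (klein i) (klein j) * u (klein i + klein j))) = quat_norm u ^+ 2.
Proof.
rewrite -/(natmx 4 (fun i j => (-1) ^+ twist (klein i) (klein j) * u (klein i + klein j))).
by rewrite det_natmx4 /klein /quat_norm !pair_boolD /=; ring.
Qed.

Local Notation kl := (fun i : 'I_4 => klein i).

Definition ext_enum : 'I_(4 + 4 + (4 + 4)) -> bool * (bool * (bool * bool)) :=
  dbl (dbl kl).

Lemma ext_divE eps (e y e' y' : bool) (k k' : bool * bool) :
  (((e, (y, k)) : central_ext eps) * ((e', (y', k')) : central_ext eps)^-1)%g =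
  (e + e' + eps * y' * (1 + y) + twist k k', (y + y', k + k')).
Proof.
case: k k' => [x z] [x' z']; rewrite ext_mulE /= !pair_boolD; congr (_, _).
by rewrite /twist; ring.
Qed.

Lemma det_ext (R : comNzRingType) (eps : bool) (w : R)
    (a : bool * (bool * (bool * bool)) -> R) :
    w ^+ 2 = (-1) ^+ eps ->
  let s y k := a (false, (y, k)) + a (true, (y, k)) in
  let t y k := a (false, (y, k)) - a (true, (y, k)) in
  \det (\matrix_(i, j)
    a ((ext_enum i : central_ext eps) * (ext_enum j : central_ext eps)^-1)%g) =
  klein_norm (fun k => s false k + s true k) * klein_norm (fun k => s false k - s true k) *
  (quat_norm (fun k => t false k + w * t true k) *
   quat_norm (fun k => t false k - w * t true k)) ^+ 2.
Proof.
move=> w2 s t.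
pose A (g h : bool * (bool * (bool * bool))) :=
  a ((g : central_ext eps) * (h : central_ext eps)^-1)%g.
rewrite (dbl_mx _ A).
set P := \matrix_(i, j) A (false, _) (false, _).
set Q := \matrix_(i, j) A (true, _) (false, _).
(* Since c is central of order 2, the blocks are P, Q, Q, P: the splitting applies with [w = 1]. *)
have -> : \matrix_(i, j) A (false, dbl kl i) (true, dbl kl j) = 1 ^+ 2 *: Q.
  rewrite expr1n scale1r; apply/matrixP => i j; rewrite !mxE /A.
  by case: (dbl _ i) (dbl _ j) => [y k] [y' k']; rewrite !ext_divE add0r addr0.
have -> : \matrix_(i, j) A (true, dbl kl i) (true, dbl kl j) = P.
  apply/matrixP => i j; rewrite !mxE /A.
  by case: (dbl _ i) (dbl _ j) => [y k] [y' k']; rewrite !ext_divE.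
rewrite det_block_twist !scale1r; congr (_ * _).
  (* At c = 1 the cocycle vanishes, and Y splits with eigenvalues 1 and -1. *)
  pose B (g h : bool * (bool * bool)) := s (g.1 + h.1) (g.2 + h.2).
  have -> : P + Q = \matrix_(i, j) B (dbl kl i) (dbl kl j).
    apply/matrixP => i j; rewrite !mxE /A /B /s.
    case: (dbl _ i) (dbl _ j) => [y k] [y' k']; rewrite !ext_divE /=.
    by case: (eps * _ * _) (twist _ _) => [] [] //; apply: addrC.
  rewrite dbl_mx /B /=.
  set U := \matrix_(i, j) s (false + false) _; set V := \matrix_(i, j) s (true + false) _.
  rewrite -[V in block_mx U V]scale1r -[X in X *: V](expr1n _ 2) det_block_twist !scale1r.
  rewrite -(det_klein (fun k => s false k + s true k))
    -(det_klein (fun k => s false k - s true k)).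
  by congr (_ * _); congr (\det _); apply/matrixP => i j; rewrite !mxE.
(* At c = -1 the cocycle becomes a sign, and Y splits with eigenvalues [w] and [- w]. *)
pose B (g h : bool * (bool * bool)) :=
  (-1) ^+ ((eps * h.1 * (1 + g.1) + twist g.2 h.2)%R : bool) * t (g.1 + h.1) (g.2 + h.2).
have -> : P - Q = \matrix_(i, j) B (dbl kl i) (dbl kl j).
  apply/matrixP => i j; rewrite !mxE /A /B /t.
  case: (dbl _ i) (dbl _ j) => [y k] [y' k']; rewrite !ext_divE /=.
  by case: (eps * _ * _) (twist _ _) => [] []; rewrite ?expr1 ?mul1r // mulN1r opprB.
have BE y k y' k' : B (y, k) (y', k') =
  (-1) ^+ ((eps * y' * (1 + y) + twist k k')%R : bool) * t (y + y') (k + k') by [].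
pose N u : 'M[R]_4 := \matrix_(i, j)
  ((-1) ^+ twist (klein i) (klein j) * u (klein i + klein j)).
rewrite dbl_mx.
transitivity (\det (block_mx (N (t false)) (w ^+ 2 *: N (t true))
                             (N (t true)) (N (t false)))).
  congr (\det _); congr (block_mx _ _ _ _); apply/matrixP => i j;
    rewrite !mxE BE ?w2 ?mulrA -?signr_addb; congr ((-1) ^+ nat_of_bool _ * _);
    by case: (eps) (twist _ _) => [] [].
rewrite det_block_twist exprMn -(det_klein_twist (fun k => t false k + w * t true k))
  -(det_klein_twist (fun k => t false k - w * t true k)).
by congr (_ * _); congr (\det _); apply/matrixP => i j; rewrite !mxE; ring.
Qed.

Definition quat_form (R : comNzRingType) (u v : bool * bool -> R) : R :=
  u (false, false) * v (false, false) - u (true, false) * v (true, false)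
  + u (false, true) * v (false, true) - u (true, true) * v (true, true).

(** The two norms differ only in the sign of the polar term [2 * w * quat_form p q]. Only [w ^+ 2]
    survives, so the value is an integer even for [w = 'i]. *)
Lemma quat_norm_conj (R : comNzRingType) (w : R) (p q : bool * bool -> R) :
  quat_norm (fun k => p k + w * q k) * quat_norm (fun k => p k - w * q k) =
  (quat_norm p + w ^+ 2 * quat_norm q) ^+ 2 - 4 * w ^+ 2 * quat_form p q ^+ 2.
Proof. by rewrite /quat_norm /quat_form; ring. Qed.

(* [s] and [t] are the images of the group ring element under [c = 1] and [c = -1];
   their first argument is the exponent of [Y]. *)
Definition ext_det (eps : bool) (s t : bool -> bool * bool -> int) : int :=
  klein_norm (fun k => s false k + s true k) * klein_norm (fun k => s false k - s true k) *
  ((quat_norm (t false) + (-1) ^+ eps * quat_norm (t true)) ^+ 2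
     - 4 * (-1) ^+ eps * quat_form (t false) (t true) ^+ 2) ^+ 2.

Lemma ext_enum_bij : bijective ext_enum.
Proof. exact/dbl_bij/dbl_bij/klein_bij. Qed.

Lemma klein_norm_int (R : comNzRingType) (u : bool * bool -> int) :
  (klein_norm u)%:~R = klein_norm (fun k => (u k)%:~R) :> R.
Proof. by rewrite /klein_norm !(rmorphM, rmorphB, rmorphXn, rmorphD). Qed.

Lemma quat_norm_int (R : comNzRingType) (u : bool * bool -> int) :
  (quat_norm u)%:~R = quat_norm (fun k => (u k)%:~R) :> R.
Proof. by rewrite /quat_norm !(rmorphB, rmorphXn, rmorphD). Qed.

Lemma quat_form_int (R : comNzRingType) (u v : bool * bool -> int) :
  (quat_form u v)%:~R = quat_form (fun k => (u k)%:~R) (fun k => (v k)%:~R) :> R.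
Proof. by rewrite /quat_form !(rmorphB, rmorphM, rmorphD). Qed.

Lemma group_det_ext eps (a : int_group_ring (central_ext eps)) :
  group_det a = ext_det eps
    (fun y k => a (false, (y, k)) + a (true, (y, k)))
    (fun y k => a (false, (y, k)) - a (true, (y, k))).
Proof.
(* [w] is the eigenvalue of [Y] on the part where [c = -1], hence complex for G. *)
pose w : algC := if eps then 'i else 1.
have w2 : w ^+ 2 = (-1) ^+ eps by rewrite /w; case: eps {a w}; rewrite ?sqrCi ?expr1n.
rewrite (group_det_reindex a ext_enum_bij); apply: (@intr_inj algC).
rewrite -det_map_mx.
pose b (g : bool * (bool * (bool * bool))) : algC := (a g)%:~R.
transitivity (\det (\matrix_(i, j)
    b ((ext_enum i : central_ext eps) * (ext_enum j : central_ext eps)^-1)%g)).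
  by congr (\det _); apply/matrixP => i j; rewrite !mxE.
rewrite (det_ext _ w2) quat_norm_conj w2 /ext_det.
have intE (F G p q c : int) :
    (F * G * ((p + (-1) ^+ eps * q) ^+ 2 - 4 * (-1) ^+ eps * c ^+ 2) ^+ 2)%:~R =
    F%:~R * G%:~R * ((p%:~R + (-1) ^+ eps * q%:~R) ^+ 2
      - 4 * (-1) ^+ eps * c%:~R ^+ 2) ^+ 2 :> algC.
  by rewrite !(rmorphM, rmorphXn, rmorphB, rmorphD, rmorph_sign).
rewrite intE !klein_norm_int !quat_norm_int quat_form_int.
by rewrite /klein_norm /quat_norm /quat_form /b !(rmorphB, rmorphD).
Qed.

Lemma eq_ext_det eps (s s' t t' : bool -> bool * bool -> int) :
  s =2 s' -> t =2 t' -> ext_det eps s t = ext_det eps s' t'.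
Proof. by move=> es et; rewrite /ext_det /klein_norm /quat_norm /quat_form !(es, et). Qed.

(** Writing s = t + 2 r builds in the congruence s = t mod 2; the two coefficients are then t + r
    and r. *)
Lemma is_integer_group_det_ext eps (n : int) :
  is_integer_group_det (central_ext eps) n <->
  exists t r : bool -> bool * bool -> int,
    ext_det eps (fun y k => t y k + 2 * r y k) t = n.
Proof.
split=> [[a <-]|[t [r <-]]].
  exists (fun y k => a (false, (y, k)) - a (true, (y, k))), (fun y k => a (true, (y, k))).
  by rewrite group_det_ext; apply: eq_ext_det => y k //; ring.
exists [ffun g => if g.1 then r g.2.1 g.2.2 else t g.2.1 g.2.2 + r g.2.1 g.2.2].
by rewrite group_det_ext; apply: eq_ext_det => y k; rewrite !ffunE /=; ring.
Qed.

(** * The set of determinants *)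

(* The second form is [(8 j - 3) (8 j' - 3)] with [j' - j] even. *)
Definition is_det16 (n : int) : Prop :=
  [\/ exists k, n = 1 + 16 * k,
      exists j k, n = (8 * j - 3) * (8 * j + 16 * k - 3) |
      exists k, n = 2 ^+ 16 * k].

Definition quad (a b c d : int) (k : bool * bool) : int :=
  match k with
  | (false, false) => a | (true, false) => b
  | (false, true) => c | (true, true) => d
  end.

Definition duo (p q : bool * bool -> int) (y : bool) := if y then q else p.

Lemma is_det16_sufficient eps n :
  is_det16 n -> is_integer_group_det (central_ext eps) n.
Proof.
move=> detn; apply/is_integer_group_det_ext.
pose t a b c d a' b' c' d' := duo (quad a b c d) (quad a' b' c' d').
case: detn => [[k ->]|[j [k ->]]|[m ->]].
(* The constant [k] moves only the trivial character of u, from 1 to 1 + 16 k; all other factors are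
   1. *)
- exists (t 1 0 0 0 0 0 0 0), (t k k k k k k k k).
  by rewrite /ext_det /klein_norm /quat_norm /quat_form /=; ring.
(* The constants move the totals of u and v from -3 to 8 j - 3 and 8 j + 16 k - 3; the other six
   linear factors multiply to 1, and Q = 1. *)
- exists (t (-1) (-1) (-1) 0 0 0 0 0).
  exists (t (j + k) (j + k) (j + k) (j + k) (- k) (- k) (- k) (- k)).
  by rewrite /ext_det /klein_norm /quat_norm /quat_form /=; ring.
(* Below [k] is added to all entries of [r]: this only changes the factor of the
   trivial character, into [4 m], while the rest of the determinant is [2 ^+ 14]. *)
have [k [|[|[|]]] ->] : exists k,
    m = 4 * k \/ m = 4 * k + 1 \/ m = 4 * k - 2 \/ m = 4 * k - 1.
  by exists ((m + 2) %/ 4)%Z; lia.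
- exists (t 0 1 1 0 (-1) 1 0 0).
  exists (t k k k k k k (k - 1) k).
  by case: eps; rewrite /ext_det /klein_norm /quat_norm /quat_form /=; ring.
- exists (t 0 0 0 0 0 1 0 1).
  exists (t k k k k k k k (k + 1)).
  by case: eps; rewrite /ext_det /klein_norm /quat_norm /quat_form /=; ring.
- exists (t (-1) (-1) 0 0 (-1) 0 0 (-1)).
  exists (t k (k - 1) k (k - 1) k k k k).
  by case: eps; rewrite /ext_det /klein_norm /quat_norm /quat_form /=; ring.
exists (t 0 (-1) 0 (-1) (-1) (-1) (-1) 1).
exists (t k k (k - 1) k k (k + 1) k k).
by case: eps; rewrite /ext_det /klein_norm /quat_norm /quat_form /=; ring.
Qed.

(** * Congruences and divisibility satisfied by every determinant *)

Lemma int_parity (x : int) : exists k, x = 2 * k \/ x = 2 * k + 1.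
Proof. by exists (x %/ 2)%Z; lia. Qed.

Lemma sqr_parity (x : int) : exists k, x ^+ 2 = x + 2 * k.
Proof.
have [k [->|->]] := int_parity x.
  by exists (2 * k ^+ 2 - k); ring.
by exists (2 * k ^+ 2 + k); ring.
Qed.

Lemma sqr_odd (x : int) : exists k, (1 + 2 * x) ^+ 2 = 1 + 8 * k.
Proof.
have [k kE] := sqr_parity x; exists (x + k).
by have -> : (1 + 2 * x) ^+ 2 = 1 + 4 * (x + x ^+ 2) by [ring]; rewrite kE; ring.
Qed.

(* [Fu] and [Fv] are the two Klein norms, with [v = u - 2 y] for the second half
   [y] of [s], which shifts [A] by [4 m] and [C] by [2 h]; both the shift of [Fu]
   and the deviation of [Q ^+ 2] from 1 are [8 * beta] modulo 16. *)
Lemma odd_mod16 (A C m h beta g k' : int) (eps : bool) :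
    let Fu := A ^+ 2 - 4 * C ^+ 2 in
    (exists a, A = 1 + 2 * a) -> m = - beta - 2 * g ->
    let Fv := (A + 4 * m) ^+ 2 - 4 * (C + 2 * h) ^+ 2 in
    let Q := 1 + 8 * k' - 4 * (-1) ^+ eps * beta ^+ 2 in
  exists G, Fv * Q ^+ 2 = Fu + 16 * G.
Proof.
move=> Fu [a Aa] mE Fv Q.
have [tau tauE] := sqr_parity beta.
have [o oE] : exists o, (-1) ^+ eps = 1 + 2 * o :> int.
  by case: eps {Q}; [exists (-1)|exists 0].
have [f0 fE] : exists f, Fu = 1 + 2 * f.
  by exists (2 * a ^+ 2 + 2 * a - 2 * C ^+ 2); rewrite /Fu Aa; ring.
(* [A], [Fu] and the sign are odd, and [m], [beta], [beta ^+ 2] have equal parity; so the difference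
   in [w1E] is even, with half [w1]. *)
pose w1 := - beta - g - a * beta - 2 * a * g - tau - o * beta - 2 * o * tau
           - f0 * (1 + 2 * o) * (beta + 2 * tau).
have w1E : A * m - (-1) ^+ eps * beta ^+ 2 * Fu = 2 * w1.
  by rewrite /w1 Aa mE oE tauE fE; ring.
pose w2 := m ^+ 2 - C * h - h ^+ 2.
pose w3 := k' + (2 * k' - (-1) ^+ eps * beta ^+ 2) ^+ 2.
have AmE : A * m = (-1) ^+ eps * beta ^+ 2 * Fu + 2 * w1 by rewrite -w1E; ring.
exists (w1 + w2 * Q ^+ 2 + w3 * (Fu + 8 * (A * m))
        - 4 * (A * m) * ((-1) ^+ eps * beta ^+ 2)).
have -> : Fv = Fu + 8 * (A * m) + 16 * w2 by rewrite /Fv /Fu /w2; ring.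
have -> : Q ^+ 2 = 1 - 8 * ((-1) ^+ eps * beta ^+ 2) + 16 * w3.
  by rewrite /w3 /Q; ring.
by rewrite AmE; ring.
Qed.

Definition klein_form (u : bool * bool -> int) : int :=
  u (false, false) * u (false, true) - u (true, false) * u (true, true).

(** The four linear factors pair up into [quat_norm u + 2 * klein_form u] and
    [quat_norm u - 2 * klein_form u]. *)
Lemma klein_normE u : klein_norm u = quat_norm u ^+ 2 - 4 * klein_form u ^+ 2.
Proof. by rewrite /klein_norm /quat_norm /klein_form; ring. Qed.

Definition total (u : bool * bool -> int) : int :=
  u (false, false) + u (true, false) + u (false, true) + u (true, true).

Definition alt_total (u : bool * bool -> int) : int :=
  u (false, false) - u (true, false) + u (false, true) - u (true, true).

Lemma alt_totalE u : alt_total u = total u - 2 * (u (true, false) + u (true, true)).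
Proof. by rewrite /alt_total /total; ring. Qed.

Lemma quat_norm_parity u : exists k, quat_norm u = alt_total u + 2 * k.
Proof.
have [ka a2] := sqr_parity (u (false, false)); have [kb b2] := sqr_parity (u (true, false)).
have [kc c2] := sqr_parity (u (false, true)); have [kd d2] := sqr_parity (u (true, true)).
by exists (ka - kb + kc - kd); rewrite /quat_norm a2 b2 c2 d2 /alt_total; ring.
Qed.

(** For [C] even both factors equal the same 1 + 8 x modulo 16, whose square is 1; for [C] odd both
    are -3 modulo 8. *)
Lemma is_det16_odd_product (k C G : int) :
  is_det16 ((1 + 8 * k - 4 * C ^+ 2) * (1 + 8 * k - 4 * C ^+ 2 + 16 * G)).
Proof.
have [c [->|->]] := int_parity C.
  pose x := k - 2 * c ^+ 2; apply: Or31; exists (x + 4 * x ^+ 2 + G * (1 + 8 * x)).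
  by rewrite /x; ring.
by apply: Or32; exists (k - 2 * c ^+ 2 - 2 * c), G; ring.
Qed.

(** The four linear factors are congruent modulo 2, hence all even. *)
Lemma klein_norm_dvd16 u : (exists k, total u = 2 * k) -> exists k, klein_norm u = 16 * k.
Proof.
case=> k; set b := u (true, false); set c := u (false, true); set d := u (true, true) => uE.
exists (k * (k - c - d) * (k - b - d) * (k - b - c)).
have aE : u (false, false) = 2 * k - b - c - d by rewrite -uE /total; ring.
by rewrite /klein_norm aE; ring.
Qed.

(** With exactly two odd coordinates, the halves of the linear factors form two pairs of opposite
    parity; the even pair adds 4 to the 16. *)
Lemma klein_norm_dvd64 u (b : bool * bool -> bool) (m : bool * bool -> int) :
    (forall k, u k = (b k)%:R + 2 * m k) ->
    (b (false, false) + b (true, false) + b (false, true) + b (true, true) = 2)%N ->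
  exists k, klein_norm u = 64 * k.
Proof.
move=> uE; rewrite /klein_norm !uE.
set ma := m (false, false); set mb := m (true, false).
set mc := m (false, true); set md := m (true, true).
have prod4 (n x y z : int) :
    exists k, 16 * ((n + 1) * (n + 1 + 2 * x) * (n + 2 * y) * (n + 2 * z)) = 64 * k.
  have [k [->|->]] := int_parity n.
    by exists ((2 * k + 1) * (2 * k + 1 + 2 * x) * (k + y) * (k + z)); ring.
  by exists ((k + 1) * (k + 1 + x) * (2 * k + 1 + 2 * y) * (2 * k + 1 + 2 * z)); ring.
pose n := ma + mb + mc + md.
pose cd := - (mc + md); pose bd := - (mb + md); pose bc := - (mb + mc).
case: (b (false, false)) (b (true, false)) (b (false, true)) (b (true, true))
  => [] [] [] [] // _; rewrite ?mulr1n ?mulr0n.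
- by have [k kE] := prod4 n cd bd bc; exists k; rewrite -kE /n /cd /bd /bc; ring.
- by have [k kE] := prod4 n bd cd bc; exists k; rewrite -kE /n /cd /bd /bc; ring.
- by have [k kE] := prod4 n bc cd bd; exists k; rewrite -kE /n /cd /bd /bc; ring.
- by have [k kE] := prod4 n (bc - 1) cd bd; exists k; rewrite -kE /n /cd /bd /bc; ring.
- by have [k kE] := prod4 n (bd - 1) cd bc; exists k; rewrite -kE /n /cd /bd /bc; ring.
by have [k kE] := prod4 n (cd - 1) bd bc; exists k; rewrite -kE /n /cd /bd /bc; ring.
Qed.

(** Each linear factor is a multiple of 4: [d] adds [4 * d] to the total and cancels in the
    others. *)
Lemma klein_norm_dvd256 u d (m : bool * bool -> int) :
    (forall k, u k = d + 2 * m k) -> (exists k, total m = 2 * k) ->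
  exists k, klein_norm u = 256 * k.
Proof.
move=> uE [k mE]; rewrite /klein_norm !uE.
set mb := m (true, false) in mE *; set mc := m (false, true) in mE *.
set md := m (true, true) in mE *.
have -> : m (false, false) = 2 * k - mb - mc - md by rewrite -mE /total; ring.
by exists ((d + k) * (k - mc - md) * (k - mb - md) * (k - mb - mc)); ring.
Qed.

Section Necessity.
Variables (eps : bool) (t r : bool -> bool * bool -> int).

Let s y k := t y k + 2 * r y k.
Let u k := s false k + s true k.
Let v k := s false k - s true k.
Let A' := quat_norm (t false) + (-1) ^+ eps * quat_norm (t true).
Let beta := quat_form (t false) (t true).
Let Q := A' ^+ 2 - 4 * (-1) ^+ eps * beta ^+ 2.

Let det_eq : ext_det eps s t = klein_norm u * klein_norm v * Q ^+ 2.
Proof. by []. Qed.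

Let A'_parity : exists k, A' = total u + 2 * k.
Proof.
have [k1 E1] := quat_norm_parity (t false); have [k2 E2] := quat_norm_parity (t true).
rewrite /A' E1 E2 !alt_totalE.
pose b k := t k (true, false) + t k (true, true).
exists (if eps then k1 - k2 - b false + b true - total (t true)
                    - total (r false) - total (r true)
        else k1 + k2 - b false - b true - total (r false) - total (r true)).
by case: eps; rewrite /b /u /s /total; ring.
Qed.

Lemma ext_det_odd : (exists k, total u = 1 + 2 * k) -> is_det16 (ext_det eps s t).
Proof.
case=> sigma sigmaE; rewrite det_eq.
have [k1 Ak] := quat_norm_parity u; rewrite alt_totalE sigmaE in Ak.
have [kA A2] := sqr_odd (sigma - (u (true, false) + u (true, true)) + k1).
have [k2 A'k] := A'_parity; rewrite sigmaE in A'k.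
have [k' A'2] := sqr_odd (sigma + k2).
(* Expanding at [v = u - 2 * s true] gives the shifts [4 * m] and [2 * h]. Here [m] is
   [- quat_form (s false) (s true)], which s = t + 2 r turns into [- beta - 2 * g]. *)
pose m := alt_total (fun k => s true k * (s true k - u k)).
pose h := klein_form (s true) *+ 2 - (u (false, false) * s true (false, true)
   + s true (false, false) * u (false, true) - u (true, false) * s true (true, true)
   - s true (true, false) * u (true, true)).
pose g := alt_total
  (fun k => t false k * r true k + r false k * t true k + 2 * r false k * r true k).
have [|| G GE] := @odd_mod16 (quat_norm u) (klein_form u) m h beta g k' eps.
- by exists (sigma - (u (true, false) + u (true, true)) + k1); rewrite Ak; ring.
- by rewrite /m /beta /g /alt_total /quat_form /u /s; ring.
have FvE : klein_norm v = (quat_norm u + 4 * m) ^+ 2 - 4 * (klein_form u + 2 * h) ^+ 2.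
  rewrite klein_normE; congr (_ ^+ 2 - 4 * _ ^+ 2).
    by rewrite /quat_norm /m /alt_total /v /u; ring.
  by rewrite /klein_form /h /klein_form /v /u; ring.
have QE : Q = 1 + 8 * k' - 4 * (-1) ^+ eps * beta ^+ 2.
  by rewrite -A'2 /Q A'k; ring.
rewrite -mulrA {1}FvE {1}QE GE klein_normE.
have -> : quat_norm u ^+ 2 = 1 + 8 * kA by rewrite -A2 Ak; ring.
exact: is_det16_odd_product.
Qed.

(** Modulo 2, [t false] is [t true] plus the constant [d]. As [t true] has even norm and alternating
    total, 4 divides [A'] and 2 divides [beta]. *)
Lemma quat_dvd16 d (m : bool * bool -> int) :
    (forall k, u k = d + 2 * m k) -> (exists k, total (t true) = 2 * k) ->
  exists k, Q = 16 * k.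
Proof.
move=> uE [rho rhoE].
pose n k := m k - r false k - r true k.
have pE k : t false k = d + 2 * n k - t true k.
  have -> : t false k = u k - t true k - 2 * (r false k + r true k) by rewrite /u /s; ring.
  by rewrite uE /n; ring.
set q := t true in rhoE pE *.
have [k2 qE] := quat_norm_parity q; rewrite alt_totalE rhoE in qE.
pose R := rho - (q (true, false) + q (true, true)); pose T := R + k2.
have {qE} qE : quat_norm q = 2 * T by rewrite qE /T /R; ring.
have altq : alt_total q = 2 * R by rewrite alt_totalE rhoE /R; ring.
pose W := quat_norm n + d * alt_total n - quat_form n q.
have A'E : A' = 4 * ((if eps then 0 else T) - d * R + W).
  have -> : A' = (1 + (-1) ^+ eps) * quat_norm q - 2 * d * alt_total q + 4 * W.
    rewrite /A' /W -/q {1}/quat_norm !pE; rewrite /quat_norm /quat_form /alt_total.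
    by move: (n) (q) => n' q'; ring.
  by rewrite qE altq; case: (eps); ring.
have betaE : beta = 2 * (d * R + quat_form n q - T).
  have -> : beta = d * alt_total q + 2 * quat_form n q - quat_norm q.
    by rewrite /beta /quat_form -/q !pE /quat_norm /alt_total; ring.
  by rewrite qE altq; ring.
exists (((if eps then 0 else T) - d * R + W) ^+ 2
        - (-1) ^+ eps * (d * R + quat_form n q - T) ^+ 2).
by rewrite /Q A'E betaE; ring.
Qed.

Lemma ext_det_even : (exists k, total u = 2 * k) -> is_det16 (ext_det eps s t).
Proof.
case=> sigma sigmaE; rewrite det_eq; apply: Or33.
have vE k : v k = u k - 2 * s true k by rewrite /u /v; ring.
have Q4 : exists k, Q = 4 * k.
  have [k kE] := A'_parity; rewrite sigmaE in kE.
  by exists ((sigma + k) ^+ 2 - (-1) ^+ eps * beta ^+ 2); rewrite /Q kE; ring.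
pose b k := (u k %% 2)%Z == 1; pose m k := (u k %/ 2)%Z.
have uE k : u k = (b k)%:R + 2 * m k by rewrite /b /m; lia.
have vE' k : v k = (b k)%:R + 2 * (m k - s true k) by rewrite vE uE; ring.
(* An even number of coordinates of [u] is odd. If it is two, the factors give 64 * 64 * 4^2 =
   2^16. *)
have [b2|[d dE]] :
    (b (false, false) + b (true, false) + b (false, true) + b (true, true) = 2)%N \/
    exists d : int, forall k, (b k)%:R = d.
- have := sigmaE; rewrite /total !uE.
  case Ea: (b (false, false)); case Eb: (b (true, false));
  case Ec: (b (false, true)); case Ed: (b (true, true)) => sE;
    first [by left | by exfalso; move: sE; rewrite ?mulr1n ?mulr0n; lia | right].
    by exists 1; case=> [[] []]; rewrite ?(Ea, Eb, Ec, Ed).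
  by exists 0; case=> [[] []]; rewrite ?(Ea, Eb, Ec, Ed).
- have [k1 k1E] := klein_norm_dvd64 uE b2; have [k2 k2E] := klein_norm_dvd64 vE' b2.
  have [k3 k3E] := Q4; exists (k1 * k2 * k3 ^+ 2).
  by rewrite k1E k2E k3E; ring.
have {}uE k : u k = d + 2 * m k by rewrite uE dE.
have {}vE' k : v k = d + 2 * (m k - s true k) by rewrite vE' dE.
have v2 : exists k, total v = 2 * k.
  by exists (sigma - total (s true)); rewrite mulrBr -sigmaE /total !vE; ring.
have [k1 k1E] : exists k, klein_norm u = 16 * k by apply: klein_norm_dvd16; exists sigma.
have [k2 k2E] := klein_norm_dvd16 v2.
(* If this total is even, so is that of [t true], and the factors give 16 * 16 * 16^2 = 2^16. *)
have [j [sE|sE]] := int_parity (total (s true)).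
- have [|k3 k3E] := quat_dvd16 uE.
    by exists (j - total (r true)); rewrite mulrBr -sE /s /total; ring.
  by exists (k1 * k2 * k3 ^+ 2); rewrite k1E k2E k3E; ring.
have [k3 k3E] := Q4.
(* Now [m] and [m - s true] have totals of opposite parity, so one Klein norm improves to 256, and
   256 * 16 * 4^2 = 2^16. *)
have [l [lE|lE]] := int_parity (total m).
- have [|k4 k4E] := klein_norm_dvd256 uE; first by exists l.
  by exists (k4 * k2 * k3 ^+ 2); rewrite k4E k2E k3E; ring.
have [|k4 k4E] := klein_norm_dvd256 vE'.
  exists (l - j); rewrite mulrBr -[2 * l](addrK 1) -lE -[2 * j](addrK 1) -sE.
  by rewrite /total; ring.
by exists (k1 * k4 * k3 ^+ 2); rewrite k1E k4E k3E; ring.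
Qed.
End Necessity.

Lemma is_det16_necessary eps n :
  is_integer_group_det (central_ext eps) n -> is_det16 n.
Proof.
case/is_integer_group_det_ext => t [r <-].
pose u k := t false k + 2 * r false k + (t true k + 2 * r true k).
have [k [uE|uE]] := int_parity (total u).
  by apply: ext_det_even; exists k.
by apply: ext_det_odd; exists k; rewrite addrC.
Qed.

(** * Transfer to the presented group and to Z_2 x D_8 *)

Lemma isog_same_integer_group_dets (K L : finGroupType) :
  ([set: K] \isog [set: L])%g -> same_integer_group_dets K L.
Proof.
by move=> isoKL n; split; apply: isog_is_integer_group_det; rewrite // isog_sym.
Qed.

Lemma presented_same_dets (G : finGroupType) :
  SmallGroup_16_13_presented G -> same_integer_group_dets G Z2xD8.
Proof.
move=> /presented_isog isoG n.
have isoH := central_ext_false_isog.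
have [GC CG] := isog_same_integer_group_dets isoG n.
have [HC CH] := isog_same_integer_group_dets isoH n.
split=> detn.
  exact/HC/is_det16_sufficient/(is_det16_necessary (eps := true))/GC.
exact/CG/is_det16_sufficient/(is_det16_necessary (eps := false))/CH.
Qed.

Lemma presented_not_isog (G : finGroupType) :
  SmallGroup_16_13_presented G -> ~ ([set: G] \isog [set: Z2xD8])%g.
Proof.
move=> /presented_isog isoG isoGH; apply: central_ext_not_isog.
rewrite isog_sym in isoG; apply: isog_trans isoG (isog_trans isoGH _).
by rewrite isog_sym central_ext_false_isog.
Qed.

Local Close Scope ring_scope.

Theorem corollary1p2 :
  (* the group presented by the given generators and relations exists *)
  (exists G : finGroupType, SmallGroup_16_13_presented G) /\
  (* it has order 16, the same integer group determinants as Z_2 x D_8,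
     and it is not isomorphic to Z_2 x D_8 *)
  (forall G : finGroupType, SmallGroup_16_13_presented G ->
     #|G| = 16 /\
     same_integer_group_dets G Z2xD8 /\
     ~ ([set: G] \isog [set: Z2xD8])%g) /\
  (* integer group determinants do not determine the group *)
  (exists K L : finGroupType,
     same_integer_group_dets K L /\ ~ ([set: K] \isog [set: L])%g).
Proof.
split; first by exists (central_ext true); apply: central_ext_presented.
split=> [G presG|]; last first.
  exists (central_ext true), Z2xD8; have pres := central_ext_presented.
  by split; [apply: presented_same_dets | apply: presented_not_isog].
split; last by split; [apply: presented_same_dets | apply: presented_not_isog].
by rewrite -cardsT (card_isog (presented_isog presG)) cardsT card_central_ext.
Qed.
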